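(* There is an absolute constant $C>0$ such that for all integers $n>4$, all positive integers $a,b$, and every induced subgraph $H$ of the shift graph $G_{n,2}$ that is $K_{a,b}$-free, one has $\chi(H)\leq C\log_2(a+b)$. (That is, $\chi(H)=\mathcal{O}(\log(a+b))$.)
   Context: All graphs are finite, simple and undirected. The shift graph $G_{n,2}$ has as vertices all pairs $(a_1,a_2)$ of integers with $1\leq a_1<a_2\leq n$; two vertices $(a_1,a_2)$ and $(b_1,b_2)$ are adjacent iff $a_2=b_1$ or $b_2=a_1$. $K_{a,b}$ is the complete bipartite graph with parts of sizes $a$ and $b$. A graph is $F$-free if it has no induced subgraph isomorphic to $F$. $\chi$ denotes the chromatic number. *)

(* Defs.v *)
From HB Require Import structures.
From mathcomp Require Import all_boot all_order all_algebra.
From mathcomp Require Import reals exp.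

Set Implicit Arguments.
Unset Strict Implicit.
Unset Printing Implicit Defensive.

Record sgraph := SGraph {
  vertex :> finType;
  edge : rel vertex;
  edge_sym : symmetric edge;
  edge_irrefl : irreflexive edge
}.

Definition graph_iso (G H : sgraph) : Prop :=
  exists2 f : G -> H, bijective f & {mono f : x y / edge x y}.

Section Induced.
Variables (G : sgraph) (S : {set G}).

Definition induced_edge : rel {x : G | x \in S} :=
  fun x y => edge (val x) (val y).

Lemma induced_edge_sym : symmetric induced_edge.
Proof. by move=> x y; apply: edge_sym. Qed.

Lemma induced_edge_irrefl : irreflexive induced_edge.
Proof. by move=> x; apply: edge_irrefl. Qed.

Definition induced : sgraph := SGraph induced_edge_sym induced_edge_irrefl.
End Induced.

Definition is_free (F G : sgraph) : Prop :=
  forall S : {set G}, ~ graph_iso F (induced S).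

Definition proper_coloring (G : sgraph) (k : nat) (c : {ffun G -> 'I_k}) : bool :=
  [forall x : G, forall y : G, edge x y ==> (c x != c y)].

Definition colorable (G : sgraph) (k : nat) : bool :=
  [exists c : {ffun G -> 'I_k}, proper_coloring c].

Lemma colorable_ex (G : sgraph) : exists k, colorable G k.
Proof.
exists #|G|; apply/existsP; exists [ffun x => enum_rank x].
apply/forallP=> x; apply/forallP=> y; apply/implyP=> xy.
rewrite !ffunE (inj_eq enum_rank_inj).
by apply: contraTneq xy => ->; rewrite edge_irrefl.
Qed.

Definition chi (G : sgraph) : nat := ex_minn (colorable_ex G).

Section CompleteBipartite.
Variables a b : nat.

Definition bip_edge : rel ('I_a + 'I_b)%type :=
  fun x y => match x, y with
             | inl _, inr _ | inr _, inl _ => true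
             | _, _ => false
             end.

Lemma bip_edge_sym : symmetric bip_edge.
Proof. by case=> x [] y. Qed.

Lemma bip_edge_irrefl : irreflexive bip_edge.
Proof. by case. Qed.

Definition complete_bipartite : sgraph := SGraph bip_edge_sym bip_edge_irrefl.
End CompleteBipartite.

Section Shift.
Variable n : nat.

(* The ground set {1, ..., n} is encoded as 'I_n = {0, ..., n-1}, by a shift
   by one, which changes neither the order nor the equality of entries. *)
Definition shift_vertex : finType := {p : 'I_n * 'I_n | p.1 < p.2}.

Definition shift_edge : rel shift_vertex :=
  fun p q => ((val p).2 == (val q).1) || ((val q).2 == (val p).1).

Lemma shift_edge_sym : symmetric shift_edge.
Proof. by move=> p q; rewrite /shift_edge orbC. Qed.

Lemma shift_edge_irrefl : irreflexive shift_edge.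
Proof.
move=> [[p1 p2] /= lt_p]; rewrite /shift_edge /= orbb.
by apply/negbTE/eqP=> e; rewrite e ltnn in lt_p.
Qed.

Definition shift_graph : sgraph := SGraph shift_edge_sym shift_edge_irrefl.
End Shift.

Definition log2 (R : realType) (x : R) : R := (ln x / ln 2)%R.

(* Main.v *)
Require Import Defs.
From mathcomp Require Import all_boot all_order all_algebra.
From mathcomp Require Import reals exp.

(** View the vertices of [H] as the arcs of an acyclic digraph [D] on ['I_n],
    so that [H] is the line graph of [D].  The arcs entering and the arcs
    leaving a vertex [m] induce a complete bipartite graph, hence [m] has
    in-degree less than [a] or out-degree less than [b].  Greedy colouring along
    the order uses [a] colours on the vertices of the first kind, and along the
    reverse order [b] colours on the others, so [D] is [a + b]-colourable.
    Finally, writing the colours of [D] with [k] bits, where [2 ^ k >= a + b],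
    and colouring an arc [(u, v)] by a position where the colours of [u] and [v]
    differ together with the bit of [u] there, yields [2 * k] colours for [H]. *)

Set Implicit Arguments.
Unset Strict Implicit.
Unset Printing Implicit Defensive.

Import Order.TTheory GRing.Theory Num.Theory.

Lemma induced_embedding_not_free (F G : sgraph) (f : F -> G) :
  injective f -> {mono f : x y / edge x y} -> ~ is_free F G.
Proof.
move=> f_inj f_mono /(_ [set f x | x : F]); apply.
have imP x : f x \in [set f x | x : F] by apply: imset_f.
exists (fun x => exist _ (f x) (imP x) : induced [set f x | x : F]) => [|x y].
  apply: inj_card_bij => [x y /(congr1 val) /f_inj //|].
  by rewrite card_sig card_imset.
exact: f_mono.
Qed.

(** Vertices are coloured by increasing [h]: the fewer than [t] predecessors of [y] are coloured
    before [y] and leave a colour free. *)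
Lemma greedy_coloring (T : finType) (r : rel T) (h : T -> nat) (t : nat) :
  (forall x y, r x y -> h x < h y) ->
  (forall y, #|[set x | r x y]| < t) ->
  exists f : T -> 'I_t, forall x y, r x y -> f x != f y.
Proof.
move=> r_lt r_deg.
suff [f fP] : exists f : T -> 'I_t,
    forall x y, h y < (\max_z h z).+1 -> r x y -> f x != f y.
  by exists f => x y; apply: fP; rewrite ltnS; apply: leq_bigmax.
elim: _.+1 => [|k [f fP]].
  (* Nothing is required yet; colour 0 exists because the degree bound at [y] forces [0 < t]. *)
  by exists (fun y => Ordinal (leq_ltn_trans (leq0n _) (r_deg y))).
have free y : exists c, c \notin [set f x | x in [set x | r x y]].
  apply/existsP; rewrite -negb_forall; apply: contraL (r_deg y) => /forallP allP.
  rewrite -leqNgt -[t in t <= _]card_ord.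
  apply: leq_trans (leq_imset_card f _); apply: subset_leq_card.
  by apply/subsetP=> c _; apply: allP.
(* Only the level [h y = k] is recoloured; predecessors lie strictly below their successors, so the
   constraints already met survive. *)
exists (fun y => if h y == k then xchoose (free y) else f y) => x y.
rewrite ltnS leq_eqVlt => /orP[/eqP hy|hy] rxy.
  rewrite hy eqxx -hy ltn_eqF ?r_lt //.
  by apply: contraNneq (xchooseP (free y)) => <-; rewrite imset_f // inE.
by rewrite !ltn_eqF ?fP // (ltn_trans _ hy) ?r_lt.
Qed.

Lemma chi_le (G : sgraph) (T : finType) (c : G -> T) :
  (forall x y, edge x y -> c x != c y) -> chi G <= #|T|.
Proof.
move=> cP; rewrite /chi; case: ex_minnP => k _; apply.
apply/existsP; exists [ffun x => enum_rank (c x)].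
apply/forallP=> x; apply/forallP=> y; apply/implyP=> xy.
by rewrite !ffunE (inj_eq enum_rank_inj) cP.
Qed.

Section ShiftSubgraph.
Variables (n : nat) (S : {set shift_graph n}).
Local Notation H := (induced S).

Definition tail (v : H) : 'I_n := (val (val v)).1.
Definition head (v : H) : 'I_n := (val (val v)).2.

Lemma tail_lt_head v : tail v < head v.
Proof. exact: valP (val v). Qed.

Lemma edgeE v w : @edge H v w = (head v == tail w) || (head w == tail v).
Proof. by []. Qed.

Lemma tail_head_inj v w : tail v = tail w -> head v = head w -> v = w.
Proof.
move=> tvw hvw; do 2 apply: val_inj.
by apply: etrans (surjective_pairing _) _; rewrite [RHS]surjective_pairing;
   congr pair.
Qed.

Lemma in_or_out_small (a b : nat) (m : 'I_n) :
  is_free (complete_bipartite a b) H ->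
  (#|[set v | head v == m]| < a) || (#|[set v | tail v == m]| < b).
Proof.
move=> freeH; rewrite !ltnNge -negb_and; apply/negP=> /andP[le_a le_b].
pose f (x : complete_bipartite a b) : H := match x with
  | inl i => enum_val (widen_ord le_a i)
  | inr j => enum_val (widen_ord le_b j)
  end.
have headf i : head (f (inl i)) = m.
  by have := enum_valP (widen_ord le_a i); rewrite inE => /eqP.
have tailf j : tail (f (inr j)) = m.
  by have := enum_valP (widen_ord le_b j); rewrite inE => /eqP.
(* As there are no loops, no arc both enters and leaves [m]: the two sides are disjoint and neither
   contains an edge. *)
have tailf_lt i : (tail (f (inl i)) == m) = false.
  by rewrite -(headf i) -val_eqE ltn_eqF ?tail_lt_head.
have headf_gt j : (head (f (inr j)) == m) = false.
  by rewrite -(tailf j) -val_eqE gtn_eqF ?tail_lt_head.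
apply: (induced_embedding_not_free (f := f)) freeH.
  move=> [i|j] [i'|j'] e.
  - by move/enum_val_inj/(congr1 val): e => /= /val_inj ->.
  - by have := headf_gt j'; rewrite -e headf eqxx.
  - by have := headf_gt j; rewrite e headf eqxx.
  - by move/enum_val_inj/(congr1 val): e => /= /val_inj ->.
move=> [i|j] [i'|j']; rewrite edgeE ?headf ?tailf ?eqxx ?orbT //.
  by rewrite ![m == _]eq_sym !tailf_lt.
by rewrite !headf_gt.
Qed.

Lemma digraph_coloring (a b : nat) :
  0 < a -> 0 < b -> is_free (complete_bipartite a b) H ->
  exists phi : 'I_n -> 'I_a + 'I_b, forall v, phi (tail v) != phi (head v).
Proof.
move=> a_gt0 b_gt0 freeH.
pose A := [set m | #|[set v | head v == m]| < a].
pose arc := fun x y => [exists v, (tail v == x) && (head v == y)].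
have arc_lt x y : arc x y -> x < y.
  by case/existsP=> v /andP[/eqP <- /eqP <-]; apply: tail_lt_head.
(* Only arcs with head in [A] constrain [f]. A vertex outside [A] thus has no predecessors, and its
   degree bound is just [0 < a]. *)
have [f fP] : exists f : 'I_n -> 'I_a,
    forall x y, [&& y \in A & arc x y] -> f x != f y.
  apply: (@greedy_coloring _ _ (@nat_of_ord n)) => [x y /andP[_ /arc_lt]//|y].
  have [yA|yA] := boolP (y \in A); last by rewrite eq_card0 // => x; rewrite inE.
  move: (yA); rewrite inE; apply: leq_ltn_trans.
  apply: leq_trans (leq_imset_card tail _); apply: subset_leq_card.
  apply/subsetP=> x; rewrite inE => /existsP[v /andP[/eqP <- hv]].
  by rewrite imset_f // inE.
have [g gP] : exists g : 'I_n -> 'I_b,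
    forall x y, [&& y \notin A & arc y x] -> g x != g y.
  (* The height [n - x] reverses the order, so the predecessors of [y] are now its
     out-neighbours. *)
  apply: (@greedy_coloring _ _ (fun x : 'I_n => n - x)) => [x y /andP[_ /arc_lt yx]|y].
    by rewrite ltn_sub2l // (ltn_trans yx).
  have [yA|yA] := boolP (y \in A); first by rewrite eq_card0 // => x; rewrite inE.
  move: (in_or_out_small y freeH) (yA); rewrite inE => /orP[->//|out_y _].
  apply: leq_ltn_trans out_y.
  apply: leq_trans (leq_imset_card head _); apply: subset_leq_card.
  apply/subsetP=> x; rewrite inE => /existsP[v /andP[tv /eqP <-]].
  by rewrite imset_f // inE.
(* The tags [inl] and [inr] separate the ends of arcs between [A] and its complement. *)
exists (fun m => if m \in A then inl (f m) else inr (g m)) => v.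
have tv_arc : arc (tail v) (head v) by apply/existsP; exists v; rewrite !eqxx.
have [tA|tA] := boolP (tail v \in A); have [hA|hA] := boolP (head v \in A) => //.
  by apply: contra_neq (fP _ _ (introT andP (conj hA tv_arc))) => -[].
by rewrite eq_sym; apply: contra_neq (gP _ _ (introT andP (conj tA tv_arc))) => -[].
Qed.

Lemma chi_line_le (T : finType) (phi : 'I_n -> T) (k : nat) :
  #|T| <= 2 ^ k -> (forall v, phi (tail v) != phi (head v)) ->
  chi H <= k * 2.
Proof.
move=> le_T phiP.
have le_T' : #|T| <= #|{ffun 'I_k -> bool}| by rewrite card_ffun card_bool card_ord.
pose bits m : {ffun 'I_k -> bool} := enum_val (widen_ord le_T' (enum_rank (phi m))).
have bits_inj m m' : bits m = bits m' -> phi m = phi m'.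
  by move=> /enum_val_inj/(congr1 val) /= /val_inj/enum_rank_inj.
have diffP v : exists i, bits (tail v) i != bits (head v) i.
  apply/existsP; rewrite -negb_forall; apply: contra (phiP v) => /forallP eqb.
  by apply/eqP/bits_inj/ffunP=> i; apply/eqP.
pose pos v := xchoose (diffP v).
rewrite -[k]card_ord -card_bool -card_prod.
apply: (@chi_le H _ (fun v => (pos v, bits (tail v) (pos v)))) => v w.
wlog hv : v w / head v = tail w => [IH|_].
  by rewrite edgeE => /orP[]/eqP e; [|rewrite eq_sym]; apply: IH; rewrite // edgeE e eqxx.
(* Equal colours would give [tail v] and [tail w = head v] the same bit at [pos v], where the bits
   of [tail v] and [head v] differ. *)
apply: contraNneq (xchooseP (diffP v)) => -[ep eb].
by rewrite -/(pos v) eb -ep hv.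
Qed.

Lemma chi_le_up_log (a b : nat) :
  0 < a -> 0 < b -> is_free (complete_bipartite a b) H ->
  chi H <= up_log 2 (a + b) * 2.
Proof.
move=> a_gt0 b_gt0 /digraph_coloring[]// phi; apply: chi_line_le.
by rewrite card_sum !card_ord up_logP.
Qed.

End ShiftSubgraph.

(** With [k = up_log 2 m], minimality gives [2 ^ (k - 1) < m], so [k - 1] is at most [log2 m]; the
    remaining 1 is too, since [2 <= m]. *)
Lemma up_log_le_log2 (R : realType) (m : nat) : 1 < m ->
  ((up_log 2 m)%:R <= 2 * log2 (m%:R : R))%R.
Proof.
move=> m_gt1; have ln2_gt0 : (0 < ln 2 :> R)%R by rewrite ln_gt0 // ltr1n.
have k_gt0 : 0 < up_log 2 m by rewrite up_log_gt0 /=.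
have log_ge j : 2 ^ j <= m -> (j%:R <= log2 (m%:R : R))%R.
  move=> le_m; rewrite /log2 ler_pdivlMr // mulr_natl -lnXn ?ltr0n //.
  by rewrite -natrX ler_ln ?posrE ?ltr0n ?expn_gt0 ?ler_nat // ltnW.
rewrite -(prednK k_gt0) -natr1 mulr_natl mulr2n lerD //; last exact: (log_ge 1%N).
by apply/log_ge/ltnW; have /andP[] := up_log_bounds (isT : 1 < 2) m_gt1.
Qed.

Theorem theorem11 (R : realType) :
  exists2 C : R, (0 < C)%R &
    forall (n a b : nat) (S : {set shift_graph n}),
      4 < n -> 0 < a -> 0 < b ->
      is_free (complete_bipartite a b) (induced S) ->
      ((chi (induced S))%:R <= C * log2 ((a + b)%N%:R : R))%R.
Proof.
(* One factor 2 counts the values of the recorded bit, the other pays for rounding the logarithm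
   up. *)
exists (2 * 2)%R => [|n a b S _ a_gt0 b_gt0 freeH]; first by rewrite mulr_gt0 ?ltr0n.
have le_chi : chi (induced S) <= 2 * up_log 2 (a + b).
  by rewrite mulnC chi_le_up_log.
apply: (@le_trans _ _ (2 * up_log 2 (a + b))%:R%R); first by rewrite ler_nat.
by rewrite natrM -mulrA ler_pM2l ?ltr0n // up_log_le_log2 // (leq_add a_gt0 b_gt0).
Qed.
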